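(* Let ancillae $A_1,\dots,A_n$ ($n\ge2$) consecutively measure a $d$-dimensional prepared quantum system $Q$, and let detectors $D_1,\dots,D_n$ amplify them. Then $$S(D_n:D_{n-1}\cdots D_1)\le S(A_n:A_{n-1}\cdots A_1)-\Sigma_n,$$ where $\Sigma_n=S(A_{n-1}|A_n)\ge0$ (computed in the unamplified state), the left side being computed in the amplified state and $S(A_n:A_{n-1}\cdots A_1)$ in the unamplified state.
   Context: $Q$ is $d$-dimensional, initially in $|Q\rangle=\sum_{x_1}\alpha^{(1)}_{x_1}|\widetilde{x}_1\rangle$. Ancilla $A_i$ ($d$-dimensional, basis $\{|x\rangle\}$, initially $|0\rangle$) measures $Q$ in the orthonormal basis $\{|\widetilde{x}_i\rangle\}$ via $\sum_x|\widetilde{x}_i\rangle\langle\widetilde{x}_i|\otimes U_x$, $U_x|0\rangle=|x\rangle$; with unitary $U^{(i)}_{x_{i-1}x_i}=\langle\widetilde{x}_i|\widetilde{x}_{i-1}\rangle$ the unamplified state is $\sum_{x_1,\dots,x_n}\alpha^{(1)}_{x_1}U^{(2)}_{x_1x_2}\cdots U^{(n)}_{x_{n-1}x_n}|\widetilde{x}_n\rangle_Q|x_1\rangle_{A_1}\cdots|x_n\rangle_{A_n}$. Amplification: detector $D_i$ (initially $|0\rangle$) copies $A_i$, $|x\rangle_{A_i}|0\rangle_{D_i}\mapsto|x\rangle_{A_i}|x\rangle_{D_i}$. Entropies are von Neumann (log base $d$) of reduced states; $S(X|Y)=S(XY)-S(Y)$, $S(X:Y)=S(X)+S(Y)-S(XY)$.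 *)

(* Defs.v *)
From HB Require Import structures.
From mathcomp Require Import all_boot all_order all_algebra.
From mathcomp Require Import boolp classical_sets reals exp.
From mathcomp Require Import complex.
Set Implicit Arguments. Unset Strict Implicit. Unset Printing Implicit Defensive.
Import Order.TTheory GRing.Theory Num.Theory.
Local Open Scope ring_scope.

Section QDefs.
Variable R : realType.
Local Notation C := (R[i]).

(* the eigenvalues of a square matrix, listed with algebraic multiplicity
   (C is algebraically closed, so the characteristic polynomial splits) *)
Definition spectrum m (M : 'M[C]_m) : seq C :=
  xget [::] (fun rs : seq C => char_poly M = \prod_(r <- rs) ('X - r%:P)).

Definition xlogb (b : R) (x : R) : R := if x == 0 then 0 else x * (ln x / ln b).

(* S(rho) = - Tr rho log_b rho = - sum over eigenvalues (which are real for a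
   density matrix) *)
Definition vN_entropy (b : R) m (rho : 'M[C]_m) : R :=
  - \sum_(l <- spectrum rho) xlogb b (complex.Re l).

(* subsystems: None = Q, Some (inl i) = ancilla A_(i+1), Some (inr i) =
   detector D_(i+1), for i : 'I_n *)
Definition sys (n : nat) : finType := option ('I_n + 'I_n).
Definition sQ {n} : sys n := None.
Definition sA {n} (i : 'I_n) : sys n := Some (inl i).
Definition sD {n} (i : 'I_n) : sys n := Some (inr i).

(* computational-basis configurations of all subsystems (each d-dimensional) *)
Definition config (n d : nat) := {ffun sys n -> 'I_d}.

(* a (pure) state vector: amplitude of each product basis vector *)
Definition state (n d : nat) := config n d -> C.

Definition subconf (n d : nat) (K : {set sys n}) : finType :=
  {ffun {x : sys n | x \in K} -> 'I_d}.

Definition restr n d (K : {set sys n}) (c : config n d) : subconf d K :=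
  [ffun x => c (val x)].

(* reduced density matrix on the subsystems K : partial trace of |psi><psi|
   over the complement of K (basis of H_K indexed via enum_val) *)
Definition rdm n d (psi : state n d) (K : {set sys n}) :
    'M[C]_(#|subconf d K|) :=
  \matrix_(i, j) \sum_(c : config n d) \sum_(c' : config n d |
        [&& restr K c == enum_val i, restr K c' == enum_val j &
            [forall x, (x \notin K) ==> (c x == c' x)]])
      psi c * conjc (psi c').

Definition Sent n d (psi : state n d) (K : {set sys n}) : R :=
  vN_entropy (d%:R) (rdm psi K).
Definition Scond n d (psi : state n d) (X Y : {set sys n}) : R :=
  Sent psi (X :|: Y) - Sent psi Y.
Definition Smut n d (psi : state n d) (X Y : {set sys n}) : R :=
  Sent psi X + Sent psi Y - Sent psi (X :|: Y).

Definition unitary d (U : 'M[C]_d) : Prop :=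
  (map_mx conjc U)^T *m U = 1%:M.

Definition zero_ord d (hd : (0 < d)%N) : 'I_d := Ordinal hd.

Definition setc n d (c : config n d) (s : sys n) (v : 'I_d) : config n d :=
  [ffun x => if x == s then v else c x].

Definition init_state n d (hd : (0 < d)%N) (q : 'cV[C]_d) : state n d :=
  fun c => if [forall x, (x != sQ) ==> (c x == zero_ord hd)]
           then q (c sQ) 0 else 0.

(* ancilla A_i measures Q in the orthonormal basis whose x-th vector is the
   x-th column of B : interaction  sum_x |x~><x~|_Q (x) U_x ,  U_x|0> = |x>.
   (Its action on states where A_i is in |0>, which is all that is used.) *)
Definition measure n d (hd : (0 < d)%N) (B : 'M[C]_d) (i : 'I_n)
    (psi : state n d) : state n d :=
  fun c => let x := c (sA i) in
    \sum_(y : 'I_d) B (c sQ) x * conjc (B y x) *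
                    psi (setc (setc c sQ y) (sA i) (zero_ord hd)).

Definition unamplified n d (hd : (0 < d)%N) (B : 'I_n -> 'M[C]_d)
    (q : 'cV[C]_d) : state n d :=
  foldl (fun psi i => measure hd (B i) i psi) (@init_state n d hd q)
        (enum 'I_n).

(* amplification: every D_i copies A_i, |x>_A |0>_D -> |x>_A |x>_D *)
Definition amplify n d (hd : (0 < d)%N) (psi : state n d) : state n d :=
  fun c => if [forall i, c (sD i) == c (sA i)]
           then psi [ffun x => if x is Some (inr _) then zero_ord hd else c x]
           else 0.

Definition Aset n (P : pred 'I_n) : {set sys n} := [set sA i | i in P].
Definition Dset n (P : pred 'I_n) : {set sys n} := [set sD i | i in P].

End QDefs.

(* Main.v *)
Require Import Defs.
From HB Require Import structures.
From mathcomp Require Import all_boot all_order all_algebra.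
From mathcomp Require Import boolp classical_sets reals exp.
From mathcomp Require Import complex ring lra.
Set Implicit Arguments. Unset Strict Implicit. Unset Printing Implicit Defensive.
Import Order.TTheory GRing.Theory Num.Theory.
Local Open Scope ring_scope.

(** Let [X_i] be the outcome recorded by [A_i], with joint law [|amplitude|^2].
    The amplified detectors are classical, so their joint entropies are the
    Shannon entropies of the [X_i], which form a Markov chain; hence
    [S(D_n : D_(n-1) ... D_1) = H(X_n) - H(X_n | X_(n-1))].  Before
    amplification [A_1 ... A_k] is purified by [Q], which carries a copy of
    [X_k], so [S(A_k ... A_1) = H(X_k)]; therefore
    [S(A_n : A_(n-1) ... A_1) = H(X_(n-1))].  As [S(A_n) = H(X_n)], the claim is
    [S(A_(n-1) A_n) <= H(X_(n-1), X_n)]: dephasing does not decrease entropy.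
    Finally [S(A_(n-1) A_n) >= H(X_n)] because the state of [A_(n-1) A_n] is
    block diagonal in the value of [A_n]. *)

(** * Spectra and von Neumann entropy *)

(** Sylvester's identity: clearing the lower left block of [M] from the right or from the left
    leaves one Schur complement for each product. *)
Lemma char_poly_mulmxC (F : comNzRingType) m p (A : 'M[F]_(m, p))
    (B : 'M[F]_(p, m)) :
  'X^p * char_poly (A *m B) = 'X^m * char_poly (B *m A).
Proof.
pose a := map_mx (@polyC F) A; pose b := map_mx (@polyC F) B.
pose M := block_mx ('X%:M : 'M[{poly F}]_m) a b 1%:M.
have E1 : \det M = char_poly (A *m B).
  transitivity (\det (M *m block_mx 1%:M 0 (- b) 1%:M)).
    by rewrite det_mulmx det_lblock !det1 !mulr1.
  rewrite mulmx_block !mulmx1 !mulmx0 !add0r mul1mx subrr det_ublock det1 mulr1.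
  by rewrite /char_poly /char_poly_mx map_mxM mulmxN.
have E2 : 'X^p * \det M = 'X^m * char_poly (B *m A).
  (* The entry ['X%:M] avoids a division by ['X] at the cost of the factor ['X^p]. *)
  transitivity (\det (block_mx 1%:M 0 (- b) ('X%:M : 'M_p) *m M)).
    by rewrite det_mulmx det_lblock det1 det_scalar mul1r.
  rewrite mulmx_block !mul1mx !mul0mx !addr0 mulmx1 mulNmx mul_mx_scalar.
  rewrite mul_scalar_mx addrC subrr det_ublock det_scalar.
  by rewrite /char_poly /char_poly_mx map_mxM mulNmx addrC.
by rewrite -E1.
Qed.

Section Entropy.
Variable R : realType.
Local Notation C := (R[i]).
Implicit Types b : R.

Lemma xlogbE b x : xlogb b x = x * (ln x / ln b).
Proof. by rewrite /xlogb; case: eqP => // ->; rewrite mul0r. Qed.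

Lemma xlogb0 b : xlogb b 0 = 0.
Proof. by rewrite xlogbE mul0r. Qed.

Lemma char_poly_splits m (M : 'M[C]_m) :
  {rs : seq C | char_poly M = \prod_(r <- rs) ('X - r%:P)}.
Proof.
have [r Hr] := closed_field_poly_normal (char_poly M); exists r.
by rewrite Hr (eqP (char_poly_monic M)) scale1r.
Qed.

(** By unique factorization any two lists of roots are permutations of each other, so the choice
    made in [spectrum] is harmless. *)
Lemma vN_entropyE b m (M : 'M[C]_m) (rs : seq C) :
  char_poly M = \prod_(r <- rs) ('X - r%:P) ->
  vN_entropy b M = - \sum_(l <- rs) xlogb b (complex.Re l).
Proof.
move=> Hrs; rewrite /vN_entropy; congr (- _).
have Hs : char_poly M = \prod_(r <- spectrum M) ('X - r%:P).
  exact: (@xgetPex _ [::] (fun rs => char_poly M = \prod_(r <- rs) ('X - r%:P))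
            (ex_intro _ rs Hrs)).
by apply: perm_big; apply: prod_XsubC_eq; rewrite -Hs.
Qed.

Lemma eq_vN_entropy b m (M N : 'M[C]_m) :
  char_poly M = char_poly N -> vN_entropy b M = vN_entropy b N.
Proof.
move=> E; have [rs Hrs] := char_poly_splits N.
by rewrite (vN_entropyE b Hrs) (@vN_entropyE b _ M rs) // E.
Qed.

(** Both products have the same nonzero eigenvalues, and the surplus zeros contribute
    [xlogb b 0 = 0]. *)
Lemma vN_entropy_mulmxC b m p (A : 'M[C]_(m, p)) (B : 'M[C]_(p, m)) :
  vN_entropy b (A *m B) = vN_entropy b (B *m A).
Proof.
have [r Hr] := char_poly_splits (A *m B).
have [s Hs] := char_poly_splits (B *m A).
have Xn k : 'X^k = \prod_(x <- nseq k (0 : C)) ('X - x%:P).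
  by rewrite big_nseq subr0 -Monoid.iteropE.
have := char_poly_mulmxC A B.
rewrite Hr Hs !Xn -!big_cat /= => /prod_XsubC_eq rs.
rewrite (vN_entropyE b Hr) (vN_entropyE b Hs); congr (- _).
have Z k : \sum_(l <- nseq k (0 : C)) xlogb b (complex.Re l) = 0.
  by rewrite big_nseq /= xlogb0 iter_addr_0 mul0rn.
have := perm_big _ rs (F := fun l => xlogb b (complex.Re l)) (P := xpredT)
  (op := +%R) (x := 0).
by rewrite !big_cat /= !Z !add0r => ->.
Qed.

Lemma vN_entropy_diag b m (M : 'M[C]_m) :
  (forall i j, i != j -> M i j = 0) ->
  vN_entropy b M = - \sum_i xlogb b (complex.Re (M i i)).
Proof.
move=> dM; rewrite (@vN_entropyE b _ M [seq M i i | i <- enum 'I_m]).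
  by rewrite big_map big_enum.
rewrite char_poly_trig; first by rewrite big_map big_enum.
apply/is_trig_mxP => i j ij; apply: dM; apply/eqP => E.
by rewrite E ltnn in ij.
Qed.

(** * Squared moduli and the spectra of Gram matrices *)

Definition sqn (z : C) : R := complex.Re z ^+ 2 + complex.Im z ^+ 2.

Lemma sqnC z : (sqn z)%:C%C = z * conjc z.
Proof. by rewrite /sqn add_Re2_Im2 normCK. Qed.

Lemma sqn_norm z : (sqn z)%:C%C = `|z| ^+ 2.
Proof. by rewrite /sqn add_Re2_Im2. Qed.

Lemma sqn_ge0 z : 0 <= sqn z.
Proof. by rewrite addr_ge0 ?sqr_ge0. Qed.

Lemma sqn0 : sqn 0 = 0.
Proof. by rewrite /sqn !expr0n addr0. Qed.

Lemma sqn_eq0 z : (sqn z == 0) = (z == 0).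
Proof.
apply/eqP/eqP => [H|->]; last exact: sqn0.
by apply/eqP; rewrite -normr_eq0 -sqrf_eq0 -sqn_norm H.
Qed.

Lemma sqnM x y : sqn (x * y) = sqn x * sqn y.
Proof. by apply: complexI; rewrite rmorphM /= !sqn_norm normrM exprMn. Qed.

Lemma sqn_sum (I : finType) (P : pred I) (F : I -> C) :
  \sum_(i | P i) F i * conjc (F i) = (\sum_(i | P i) sqn (F i))%:C%C.
Proof. by rewrite rmorph_sum /=; apply: eq_bigr => i _; rewrite sqnC. Qed.

Lemma cauchy_schwarz (I : finType) (P : pred I) (u v : I -> C) :
  `|\sum_(i | P i) u i * v i| ^+ 2 <=
  (\sum_(i | P i) `|u i| ^+ 2) * (\sum_(i | P i) `|v i| ^+ 2).
Proof.
have [v0|vn0] := eqVneq (\sum_(i | P i) `|v i| ^+ 2) 0.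
  rewrite v0 mulr0 big1 ?normr0 ?expr0n// => i Pi.
  have := psumr_eq0P (fun i _ => exprn_ge0 2 (normr_ge0 (v i))) v0.
  by move=> /(_ i Pi) /eqP; rewrite sqrf_eq0 normr_eq0 => /eqP ->; rewrite mulr0.
set s := \sum_(i | P i) u i * v i; set V := \sum_(i | P i) `|v i| ^+ 2 in vn0 *.
have V0 : 0 < V by rewrite lt0r vn0 sumr_ge0// => i _; rewrite exprn_ge0.
have VR : Num.conj V = V by apply/CrealP/gtr0_real.
set U := (\sum_(i | P i) _).
(* The summands come from [V] times the component of [u] orthogonal to [conjc v]. *)
have : 0 <= \sum_(i | P i) `|V * u i - s * conjc (v i)| ^+ 2.
  by apply: sumr_ge0 => i _; rewrite exprn_ge0.
have -> : \sum_(i | P i) `|V * u i - s * conjc (v i)| ^+ 2 =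
    V * (V * U - `|s| ^+ 2).
  transitivity (\sum_(i | P i) ((V * V) * `|u i| ^+ 2 - V * conjc s * (u i * v i)
      - V * s * conjc (u i * v i) + `|s| ^+ 2 * `|v i| ^+ 2)).
    apply: eq_bigr => i _; rewrite !normCK.
    rewrite rmorphB /= !rmorphM /= VR conjCK.
    change (Num.conj (v i)) with (conjc (v i)).
    change (Num.conj (u i)) with (conjc (u i)).
    change (Num.conj s) with (conjc s); ring.
  rewrite big_split !sumrB -!mulr_sumr -rmorph_sum /= -/s -/U -/V.
  by rewrite normCK; change (Num.conj s) with (conjc s); ring.
by rewrite pmulr_rge0// subr_ge0 mulrC.
Qed.

Lemma gram_spectral b m p (V : 'M[C]_(m, p)) (M := V *m (map_mx conjc V)^T) :
  exists (W : 'M[C]_m) (l : 'I_m -> R),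
  [/\ W *m (map_mx conjc W)^T = 1%:M, forall r, 0 <= l r,
      W *m M = \matrix_(r, i) ((l r)%:C%C * W r i)
    & vN_entropy b M = - \sum_r xlogb b (l r)].
Proof.
have hM : M \is hermsymmx.
  apply/is_hermitianmxP; rewrite expr0 scale1r /M trmx_mul trmxK.
  rewrite map_mxM; congr (_ *m _); last by rewrite map_trmx.
  by apply/matrixP => i j; rewrite !mxE; exact/esym/conjCK.
have /hermitian_normalmx/orthomx_spectralP := hM.
set W := spectralmx M; set D := spectral_diag M => ME.
have Wu := spectral_unitarymx M; rewrite -/W in Wu.
have WW : W *m (map_mx conjc W)^T = 1%:M by rewrite map_trmx; apply/unitarymxP.
have WM : W *m M = diag_mx D *m W.
  by rewrite ME !mulmxA mulmxV ?mul1mx// spectral_unit.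
have Dge r : 0 <= D 0 r.
  (* The eigenvalue is a diagonal entry of [M] in the eigenbasis, hence the squared norm of row [r]
     of [W *m V]. *)
  have -> : D 0 r = \sum_k `|(W *m V) r k| ^+ 2.
    have : (W *m M *m (map_mx conjc W)^T) r r = D 0 r.
      by rewrite WM -mulmxA WW mulmx1 mxE eqxx.
    move=> <-; rewrite /M mulmxA -mulmxA -trmx_mul -map_mxM mxE.
    by apply: eq_bigr => k _; rewrite normCK !mxE.
  by apply: sumr_ge0 => k _; rewrite exprn_ge0.
have DR r : (complex.Re (D 0 r))%:C%C = D 0 r by apply/RRe_real/ger0_real.
exists W, (fun r => complex.Re (D 0 r)); split => //.
- by move=> r; rewrite -ler0c DR.
- by rewrite WM mul_diag_mx; apply/matrixP => r i; rewrite !mxE DR.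
- rewrite ME -mulmxA vN_entropy_mulmxC -mulmxA mulmxV ?spectral_unit// mulmx1.
  rewrite vN_entropy_diag => [|i j ij]; last by rewrite mxE (negPf ij).
  by congr (- _); apply: eq_bigr => i _; rewrite mxE eqxx.
Qed.

(** Weighted form of [ln t <= t - 1] at [t = y / x]. The last hypothesis covers [y = 0], where [ln]
    takes a default value instead of minus infinity. *)
Lemma gibbs (w x y : R) : 0 <= w -> 0 <= x -> 0 <= y -> (y = 0 -> w * x = 0) ->
  w * (x * ln y) <= w * (x * ln x) + w * (y - x).
Proof.
move=> w0 x0; rewrite le_eqVlt => /predU1P[<- /(_ erefl) wx|y0 _].
  by rewrite !mulrA wx !mul0r add0r mulrBr wx mulr0 subr0.
rewrite -mulrDr ler_wpM2l//.
move: x0; rewrite le_eqVlt => /predU1P[<-|x0].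
  by rewrite !mul0r add0r subr0 ltW.
have -> : ln y = ln x + ln (1 + (y / x - 1)).
  by rewrite addrCA subrr addr0 -lnM ?posrE ?divr_gt0// mulrCA divff ?mulr1 ?gt_eqF.
rewrite mulrDr lerD2l.
have : ln (1 + (y / x - 1)) <= y / x - 1.
  by apply: le_ln1Dx; rewrite ltrBrDl subrr divr_gt0.
move=> /(ler_wpM2l (ltW x0)) /le_trans; apply.
by rewrite mulrBr mulr1 mulrCA divff ?mulr1// gt_eqF.
Qed.

(** Unitarity of [W] on both sides makes the squared moduli of its entries a doubly stochastic
    matrix. *)
Lemma gram_weights b m p (V : 'M[C]_(m, p)) (M := V *m (map_mx conjc V)^T) :
  exists (W : 'M[C]_m) (l : 'I_m -> R),
  [/\ (forall r, \sum_i sqn (W r i) = 1) /\ (forall i, \sum_r sqn (W r i) = 1),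
      forall r, 0 <= l r,
      forall i, complex.Re (M i i) = \sum_r sqn (W r i) * l r,
      W *m M = \matrix_(r, i) ((l r)%:C%C * W r i)
    & vN_entropy b M = - \sum_r xlogb b (l r)].
Proof.
have [W [l [WW l0 WM S]]] := gram_spectral b V.
have WW' := mulmx1C WW; exists W, l; split => //.
  split=> k; apply: complexI; rewrite -sqn_sum.
    have /matrixP/(_ k k) := WW; rewrite !mxE eqxx; apply: etrans.
    by apply: eq_bigr => i _; rewrite !mxE.
  have /matrixP/(_ k k) := WW'; rewrite !mxE eqxx; apply: etrans.
  by apply: eq_bigr => i _; rewrite !mxE mulrC.
move=> i; have -> : M = (map_mx conjc W)^T *m (W *m M).
  by rewrite mulmxA WW' mul1mx.
rewrite WM mxE.
have -> : \sum_r sqn (W r i) * l r = complex.Re ((\sum_r sqn (W r i) * l r)%:C%C) by [].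
congr complex.Re; rewrite rmorph_sum /=; apply: eq_bigr => r _.
by rewrite !mxE rmorphM /= sqnC; ring.
Qed.

Lemma xlogb_sum b (I : finType) (f : I -> R) :
  \sum_i xlogb b (f i) = (\sum_i f i * ln (f i)) / ln b.
Proof. by rewrite mulr_suml; apply: eq_bigr => i _; rewrite xlogbE mulrA. Qed.

Lemma gram_diag_ge0 m p (V : 'M[C]_(m, p)) i :
  0 <= complex.Re ((V *m (map_mx conjc V)^T) i i).
Proof.
rewrite mxE; under eq_bigr do rewrite !mxE.
by rewrite sqn_sum /= sumr_ge0// => k _; exact: sqn_ge0.
Qed.

(* Dephasing: the diagonal is a doubly stochastic image of the spectrum. *)
Lemma vN_entropy_le_diag b m p (V : 'M[C]_(m, p)) : 1 <= b ->
  vN_entropy b (V *m (map_mx conjc V)^T) <=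
  - \sum_i xlogb b (complex.Re ((V *m (map_mx conjc V)^T) i i)).
Proof.
move=> b1; have [W [l [[w1 w2] l0 Mii _ ->]]] := gram_weights b V.
set M := V *m _ in Mii *; pose q i := complex.Re (M i i).
pose w r i := sqn (W r i); have {}w1 r : \sum_i w r i = 1 := w1 r.
have {}w2 i : \sum_r w r i = 1 := w2 i.
have {}Mii i : q i = \sum_r w r i * l r := Mii i.
(* For [b = 1] the inverse of [ln b = 0] is [0], so the common factor is still nonnegative. *)
rewrite lerN2 !xlogb_sum ler_wpM2r ?invr_ge0 ?ln_ge0//.
have w0 r i : 0 <= w r i by exact: sqn_ge0.
have -> : \sum_i q i * ln (q i) = \sum_i \sum_r w r i * (l r * ln (q i)).
  apply: eq_bigr => i _; rewrite {1}Mii mulr_suml.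
  by apply: eq_bigr => r _; rewrite mulrA.
(* The added terms cancel in total, each half of their double sum being [\sum_i q i]; they permit a
   termwise use of [gibbs]. *)
have -> : \sum_r l r * ln (l r) =
    \sum_i \sum_r (w r i * (l r * ln (l r)) + w r i * (q i - l r)).
  under [RHS]eq_bigr do rewrite big_split; rewrite big_split /=.
  rewrite [X in _ = X + _]exchange_big /=.
  under [X in _ = X + _]eq_bigr do rewrite -mulr_suml w1 mul1r.
  have -> : \sum_i \sum_r w r i * (q i - l r) =
      \sum_i \sum_r w r i * q i - \sum_i \sum_r w r i * l r.
    by rewrite -sumrB; apply: eq_bigr => i _; rewrite -sumrB;
       apply: eq_bigr => r _; rewrite mulrBr.
  rewrite [X in _ = _ + (X - _)](_ : _ = \sum_i q i); last first.
    by apply: eq_bigr => i _; rewrite -mulr_suml w2 mul1r.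
  rewrite [X in _ = _ + (_ - X)](_ : _ = \sum_i q i); last first.
    by apply: eq_bigr => i _; rewrite Mii.
  by rewrite subrr addr0.
apply: ler_sum => i _; apply: ler_sum => r _; apply: gibbs => //.
  exact: gram_diag_ge0.
move=> qi0; have wl0 s : 0 <= w s i * l s by rewrite mulr_ge0.
have := psumr_eq0P (P := xpredT) (fun s _ => wl0 s).
by rewrite -Mii => /(_ qi0 r isT).
Qed.

(** By block diagonality the restriction of [u] to the block of [i0] is again an eigenvector;
    Cauchy-Schwarz bounds its quadratic form by the block trace. *)
Lemma gram_block_eigenvalue m p (V : 'M[C]_(m, p)) (X : eqType) (g : 'I_m -> X)
    (M := V *m (map_mx conjc V)^T) (u : 'rV[C]_m) (l : R) (i0 : 'I_m) :
  (forall i j, g i != g j -> M i j = 0) ->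
  u *m M = l%:C%C *: u -> u 0 i0 != 0 ->
  l <= \sum_(j | g j == g i0) complex.Re (M j j).
Proof.
move=> Mblock uM ui0; pose P := [pred j | g j == g i0].
pose N := \sum_(j | P j) `|u 0 j| ^+ 2.
have N0 : 0 < N.
  rewrite /N (bigD1 i0) /= ?eqxx// ltr_pwDl ?exprn_gt0 ?normr_gt0//.
  by apply: sumr_ge0 => i _; rewrite exprn_ge0.
have Mii j : (complex.Re (M j j))%:C%C = \sum_k `|V j k| ^+ 2.
  rewrite /M mxE; under eq_bigr do rewrite !mxE.
  by rewrite sqn_sum /= rmorph_sum; apply: eq_bigr => k _; exact: sqn_norm.
have uMP j : P j -> \sum_(i | P i) u 0 i * M i j = l%:C%C * u 0 j.
  move=> /= /eqP Pj; have /matrixP/(_ 0 j) := uM; rewrite !mxE => <-.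
  rewrite [RHS](bigID P) /= [X in _ = _ + X]big1 ?addr0// => i Pi.
  by rewrite Mblock ?mulr0// Pj.
suff H : l%:C%C * N <= N * (\sum_(j | P j) complex.Re (M j j))%:C%C.
  by move: H; rewrite mulrC ler_pM2l// lecR.
have -> : l%:C%C * N = \sum_k `|\sum_(i | P i) u 0 i * V i k| ^+ 2.
  transitivity (\sum_(j | P j) (\sum_(i | P i) u 0 i * M i j) * conjc (u 0 j)).
    by rewrite mulr_sumr; apply: eq_bigr => j Pj; rewrite uMP// normCK mulrA.
  transitivity (\sum_k \sum_(j | P j) \sum_(i | P i)
      (u 0 i * V i k) * conjc (u 0 j * V j k)); last first.
    apply: eq_bigr => k _; rewrite normCK rmorph_sum mulr_sumr.
    by apply: eq_bigr => j _; rewrite mulr_suml.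
  rewrite exchange_big; apply: eq_bigr => j _.
  rewrite exchange_big mulr_suml; apply: eq_bigr => i _.
  rewrite /M mxE mulr_sumr mulr_suml; apply: eq_bigr => k _.
  by rewrite !mxE rmorphM /=; ring.
rewrite rmorph_sum /=; under [X in _ <= _ * X]eq_bigr do rewrite Mii.
rewrite exchange_big mulr_sumr; apply: ler_sum => k _.
exact: cauchy_schwarz.
Qed.

(* Every eigenvector with weight on a block has its eigenvalue bounded by the
   trace of that block, so the spectrum is finer than the block traces. *)
Lemma vN_entropy_ge_block b m p (V : 'M[C]_(m, p)) (X : eqType) (g : 'I_m -> X)
    (M := V *m (map_mx conjc V)^T) : 1 <= b ->
  (forall i j, g i != g j -> M i j = 0) ->
  - \sum_i complex.Re (M i i) *
      (ln (\sum_(j | g j == g i) complex.Re (M j j)) / ln b) <= vN_entropy b M.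
Proof.
move=> b1 Mblock; have [W [l [[w1 _] l0 Mii WM]]] := gram_weights b V.
rewrite -/M => ->; pose w r i := sqn (W r i); have {}w1 r : \sum_i w r i = 1 := w1 r.
have {}Mii i : complex.Re (M i i) = \sum_r w r i * l r := Mii i.
have w0 r i : 0 <= w r i by exact: sqn_ge0.
rewrite lerN2 xlogb_sum.
rewrite [leRHS](_ : _ = (\sum_i complex.Re (M i i) *
   ln (\sum_(j | g j == g i) complex.Re (M j j))) / ln b); last first.
  by rewrite mulr_suml; apply: eq_bigr => i _; rewrite mulrA.
rewrite ler_wpM2r ?invr_ge0 ?ln_ge0//.
have -> : \sum_r l r * ln (l r) = \sum_i \sum_r w r i * (l r * ln (l r)).
  rewrite exchange_big /=.
  by apply: eq_bigr => r _; rewrite -mulr_suml w1 mul1r.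
apply: ler_sum => i _; rewrite {1}Mii mulr_suml; apply: ler_sum => r _.
rewrite -mulrA; have [wri0|wri0] := eqVneq (w r i) 0; first by rewrite wri0 !mul0r.
rewrite ler_wpM2l//; have := l0 r; rewrite le_eqVlt => /predU1P[<-|lr0].
  by rewrite !mul0r.
have lp : l r <= \sum_(j | g j == g i) complex.Re (M j j).
  apply: (gram_block_eigenvalue (u := row r W)) => //.
    by rewrite -row_mul WM; apply/rowP => j; rewrite !mxE.
  by rewrite mxE -sqn_eq0.
by rewrite ler_wpM2l ?(ltW lr0)// ler_ln ?posrE// (lt_le_trans lr0).
Qed.

End Entropy.

(** * Reduced density matrices *)

Section PointEntropy.
Variable R : realType.

(* Shannon entropy of the image by [h] of the weight [m], written as a sum over
   the sample space so that it only depends on the partition defined by [h]. *)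
Definition shannon (b : R) (I : finType) (m : I -> R) (X : eqType) (h : I -> X) :=
  - \sum_i m i * (ln (\sum_(j | h j == h i) m j) / ln b).

Lemma shannon_image b (I X : finType) (m : I -> R) (h : I -> X) :
  - \sum_x xlogb b (\sum_(i | h i == x) m i) = shannon b m h.
Proof.
congr (- _); rewrite [RHS](partition_big h xpredT)//=.
apply: eq_bigr => x _; rewrite xlogbE mulr_suml.
by apply: eq_bigr => i /eqP ->.
Qed.

(** Points of zero weight affect neither the outer sum nor the class sums, so only the partition of
    the support matters. *)
Lemma eq_shannon b (I : finType) (m : I -> R) (X Y : eqType)
    (h : I -> X) (k : I -> Y) :
  (forall i j, m i != 0 -> m j != 0 -> (h i == h j) = (k i == k j)) ->
  shannon b m h = shannon b m k.
Proof.
move=> hk; congr (- _); apply: eq_bigr => i _.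
have [->|mi] := eqVneq (m i) 0; first by rewrite !mul0r.
congr (_ * (ln _ / _)); rewrite [LHS]big_mkcond [RHS]big_mkcond.
apply: eq_bigr => j _; have [->|mj] := eqVneq (m j) 0; first by rewrite !if_same.
by rewrite hk.
Qed.

End PointEntropy.

(** * Splitting configurations along a set of sites *)

Section Configurations.
Variables (n d : nat).
Implicit Types (K : {set sys n}) (c : config n d).

Lemma eq_restr K c c' :
  reflect (forall x, x \in K -> c x = c' x) (restr K c == restr K c').
Proof.
apply: (iffP eqP) => [/ffunP E x xK|E]; last first.
  by apply/ffunP => -[x xK]; rewrite !ffunE /= E.
by have := E (exist _ x xK); rewrite !ffunE.
Qed.

Definition over K (s : subconf d K) c : config n d :=
  [ffun x => if insub x is Some u then s u else c x].

Lemma over_out K (s : subconf d K) c x : x \notin K -> over s c x = c x.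
Proof. by move=> xK; rewrite ffunE insubN. Qed.

Lemma restr_over K (s : subconf d K) c : restr K (over s c) = s.
Proof. by apply/ffunP => u; rewrite !ffunE valK. Qed.

Lemma over_restr K c c' x : x \in K -> over (restr K c) c' x = c x.
Proof. by move=> xK; rewrite ffunE insubT ffunE. Qed.

Lemma over_id K (s : subconf d K) c c' :
  restr K c = s -> (forall x, x \notin K -> c x = c' x) -> over s c' = c.
Proof.
move=> <- E; apply/ffunP => x; have [xK|xK] := boolP (x \in K).
  exact: over_restr.
by rewrite over_out ?E.
Qed.

Lemma eq_over K (s : subconf d K) c c' :
  (forall x, x \notin K -> c x = c' x) -> over s c = over s c'.
Proof. by move=> E; apply: over_id => [|x xK]; rewrite ?restr_over ?over_out ?E. Qed.

Lemma over_inj K (s : subconf d K) c c' :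
  over s c = over s c' -> forall x, x \notin K -> c x = c' x.
Proof. by move=> E x xK; rewrite -(over_out s c xK) E over_out. Qed.

Lemma setc_same c x v : setc c x v x = v.
Proof. by rewrite ffunE eqxx. Qed.

Lemma setc_other c x v y : y != x -> setc c x v y = c y.
Proof. by move=> /negPf yx; rewrite ffunE yx. Qed.

Lemma setc_id c x v : c x = v -> setc c x v = c.
Proof. by move=> <-; apply/ffunP => y; rewrite ffunE; case: eqP => // ->. Qed.

Lemma setc_setc c x v w : setc (setc c x v) x w = setc c x w.
Proof. by apply/ffunP => y; rewrite !ffunE; case: eqP. Qed.

Lemma restr_setc K c x v : x \notin K -> restr K (setc c x v) = restr K c.
Proof.
move=> xK; apply/eqP/eq_restr => y yK; rewrite setc_other//.
by apply: contraNneq xK => <-.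
Qed.

Lemma over_setc K (s : subconf d K) c x v : x \notin K ->
  over s (setc c x v) = setc (over s c) x v.
Proof.
move=> xK; apply: over_id => [|y yK]; first by rewrite restr_setc// restr_over.
by rewrite !ffunE insubN.
Qed.

Lemma sum_site (V : nmodType) (F : config n d -> V) (x : sys n) (v0 : 'I_d) :
  \sum_c F c = \sum_(c : config n d | c x == v0) \sum_v F (setc c x v).
Proof.
rewrite pair_big_dep /= (reindex_onto (fun p => setc p.1 x p.2)
  (fun c => (setc c x v0, c x))) /=; last by move=> c _; rewrite setc_setc setc_id.
apply: eq_bigl => -[c v] /=; rewrite andbT xpair_eqE setc_setc setc_same eqxx !andbT.
apply/eqP/eqP => [<-|cx]; [exact: setc_same | exact: setc_id].
Qed.

Lemma eq_sum_site (V : nmodType) (F G : config n d -> V) (x : sys n) :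
  (forall c, \sum_v F (setc c x v) = \sum_v G (setc c x v)) ->
  \sum_c F c = \sum_c G c.
Proof.
(* For [d = 0] there is no base value at [x], but no configuration either. *)
move=> FG; case: (posnP d) => [d0|d0].
  by apply: eq_bigr => c; exfalso; case: (c x) => m; rewrite d0.
rewrite !(sum_site _ x (Ordinal d0)).
by apply: eq_bigr => c _.
Qed.

End Configurations.

Lemma sum_enum_val (V : nmodType) (T : finType) (F : T -> V) :
  \sum_(i < #|T|) F (enum_val i) = \sum_t F t.
Proof. by rewrite -(@big_enum_val _ _ _ _ T). Qed.

(** * Entropies of reduced states from the support of the amplitudes *)

Section ReducedStates.
Variables (R : realType) (n d : nat).
Local Notation C := (R[i]).
Implicit Types (K : {set sys n}) (c : config n d) (psi : state R n d).

Definition weight psi c : R := sqn (psi c).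

Lemma weight_neq0 psi c : (weight psi c != 0) = (psi c != 0).
Proof. by rewrite sqn_eq0. Qed.

(** The second configuration of the double sum is forced: it follows [c] outside [K] and [j] on
    [K]. *)
Lemma rdmE psi K i j : rdm psi K i j =
  \sum_(c | restr K c == enum_val i) psi c * conjc (psi (over (enum_val j) c)).
Proof.
rewrite mxE [RHS]big_mkcond; apply: eq_bigr => c _.
have [_|ci] := boolP (restr K c == enum_val i); last by rewrite big_pred0.
rewrite (big_pred1 (over (enum_val j) c)) // => c' /=.
apply/andP/eqP => [[/eqP c'j /forallP E]|->].
  by apply/esym/over_id => // x xK; rewrite (eqP (implyP (E x) xK)).
split; first by rewrite restr_over.
by apply/fintype.forallP => x; apply/implyP => xK; rewrite over_out.
Qed.

Lemma rdm_diag psi K i :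
  complex.Re (rdm psi K i i) = \sum_(c | restr K c == enum_val i) weight psi c.
Proof.
rewrite rdmE -[RHS]/(complex.Re (_%:C)%C) -sqn_sum; congr complex.Re.
by apply: eq_bigr => c /eqP ci; rewrite (over_id ci).
Qed.

Lemma rdm_diag_entropy b psi K :
  - \sum_i xlogb b (complex.Re (rdm psi K i i)) = shannon b (weight psi) (restr K).
Proof.
under eq_bigr do rewrite rdm_diag.
rewrite (sum_enum_val (fun s => xlogb b (\sum_(c | restr K c == s) weight psi c))).
exact: shannon_image.
Qed.

Lemma rdm_neq0 psi K i j : rdm psi K i j != 0 -> exists c c',
  [/\ psi c != 0, psi c' != 0, restr K c = enum_val i, restr K c' = enum_val j
    & forall x, x \notin K -> c x = c' x].
Proof.
move=> nz; have [c /andP[/eqP ci cnz]] : exists c, (restr K c == enum_val i) &&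
    (psi c * conjc (psi (over (enum_val j) c)) != 0).
  apply/fintype.existsP; apply: contraNT nz => /fintype.existsPn nz; rewrite rdmE big1// => c ci.
  by apply/eqP; have := nz c; rewrite ci negbK.
move: cnz; rewrite mulf_eq0 negb_or conjc_eq0 => /andP[c1 c2].
exists c, (over (enum_val j) c); split=> //; first exact: restr_over.
by move=> x xK; rewrite over_out.
Qed.

(** An off-diagonal entry needs two support configurations that differ on [K] and agree outside;
    here the environment determines the part on [K]. *)
Lemma Sent_diag psi K :
  (forall c c', psi c != 0 -> psi c' != 0 ->
     (forall x, x \notin K -> c x = c' x) -> restr K c = restr K c') ->
  Sent psi K = shannon d%:R (weight psi) (restr K).
Proof.
move=> H; rewrite -rdm_diag_entropy; apply: vN_entropy_diag => i j ij.
apply: contraNeq ij => /rdm_neq0[c [c' [c1 c2 ci cj E]]]; apply/eqP/enum_val_inj.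
by rewrite -ci -cj; exact: H.
Qed.

Hypothesis hd : (0 < d)%N.

Definition clear K c := over (restr K [ffun=> zero_ord hd]) c.

Lemma clear_over K (s : subconf d K) c : clear K (over s c) = clear K c.
Proof. by apply: eq_over => x xK; rewrite over_out. Qed.

Lemma over_clear K c : over (restr K c) (clear K c) = c.
Proof. by apply: over_id => // x xK; rewrite over_out. Qed.

Lemma eq_clear K c c' :
  reflect (forall x, x \notin K -> c x = c' x) (clear K c == clear K c').
Proof. by apply: (iffP eqP) => [E x xK|E]; [exact: over_inj E x xK | exact: eq_over]. Qed.

(* Amplitude matrix of [psi]: system against environment, the environment
   configurations being represented by those that vanish on [K]. *)
Definition amp_mx psi K : 'M[C]_(#|subconf d K|, #|config n d|) :=
  \matrix_(i, k) (if clear K (enum_val k) == enum_val k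
                  then psi (over (enum_val i) (enum_val k)) else 0).

(** The partial trace is a matrix product, each environment configuration being counted once through
    its cleared representative. *)
Lemma rdm_gram psi K :
  rdm psi K = amp_mx psi K *m (map_mx conjc (amp_mx psi K))^T.
Proof.
apply/matrixP => i j; rewrite rdmE mxE.
rewrite (reindex_onto (over (enum_val i)) (clear K)) => [|c /eqP <-]; last first.
  exact: over_clear.
under [RHS]eq_bigr do rewrite !mxE.
rewrite (sum_enum_val (fun z => (if clear K z == z then psi (over (enum_val i) z) else 0)
  * conjc (if clear K z == z then psi (over (enum_val j) z) else 0))).
rewrite [LHS]big_mkcond; apply: eq_bigr => z _.
rewrite restr_over eqxx clear_over /=; case: ifP => _; last by rewrite mul0r.
by congr (_ * conjc (psi _)); apply: eq_over => x xK; rewrite over_out.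
Qed.

Lemma Sent_le_diag psi K :
  Sent psi K <= shannon d%:R (weight psi) (restr K).
Proof.
rewrite -rdm_diag_entropy /Sent rdm_gram; apply: (vN_entropy_le_diag (amp_mx psi K)).
by rewrite ler1n.
Qed.

(** The environment knows the value at [x], so the reduced matrix is block diagonal in it; the block
    traces form the law of that value. *)
Lemma Sent_ge_block psi K (x : sys n) : x \in K ->
  (forall c c', psi c != 0 -> psi c' != 0 ->
     (forall y, y \notin K -> c y = c' y) -> c x = c' x) ->
  shannon d%:R (weight psi) (fun c => c x) <= Sent psi K.
Proof.
move=> xK H; pose u : {x : sys n | x \in K} := exist _ x xK.
have ux c : c x = restr K c u by rewrite ffunE.
pose g (i : 'I_#|subconf d K|) := (enum_val i : subconf d K) u.
apply: le_trans (_ : - \sum_i complex.Re (rdm psi K i i) *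
    (ln (\sum_(j | g j == g i) complex.Re (rdm psi K j j)) / ln d%:R) <= _).
  rewrite /shannon lerN2 le_eqVlt; apply/orP; left; apply/eqP.
  pose P (v : 'I_d) := \sum_(c' : config n d | c' x == v) weight psi c'.
  transitivity (\sum_(s : subconf d K) (\sum_(c | restr K c == s) weight psi c) *
      (ln (P (s u)) / ln d%:R)); last first.
    rewrite [RHS](partition_big (restr K) xpredT)//=; apply: eq_bigr => s _.
    by rewrite mulr_suml; apply: eq_bigr => c /eqP <-; rewrite -ux.
  rewrite -(sum_enum_val (fun s => (\sum_(c | restr K c == s) weight psi c) *
      (ln (P (s u)) / ln d%:R))).
  apply: eq_bigr => i _; rewrite rdm_diag; congr (_ * (ln _ / _)).
  under eq_bigr do rewrite rdm_diag.
  rewrite big_mkcond (sum_enum_val (fun s : subconf d K => if s u == g i then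
     \sum_(c | restr K c == s) weight psi c else 0)) -big_mkcond /P.
  rewrite [RHS](partition_big (restr K) (fun s => s u == g i)) => [|c]; last first.
    by rewrite ux.
  apply: eq_bigr => s /eqP su; apply: eq_bigl => c.
  by rewrite ux; case: eqP => [->|]; rewrite ?andbF// su eqxx.
rewrite /Sent; have hb : 1 <= d%:R :> R by rewrite ler1n.
have := @vN_entropy_ge_block R d%:R _ _ (amp_mx psi K) _ g hb.
rewrite -rdm_gram; apply => i j; apply: contraNeq.
move=> /rdm_neq0[c [c' [c1 c2 ci cj E]]].
by rewrite /g -ci -cj -!ux (H c c').
Qed.

(* By the Schmidt decomposition the entropy is that of the environment, whose
   reduced state is diagonal here. *)
Lemma Sent_dual psi K :
  (forall c c', psi c != 0 -> psi c' != 0 ->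
     (forall x, x \in K -> c x = c' x) -> c = c') ->
  Sent psi K = shannon d%:R (weight psi) (clear K).
Proof.
(* Exchanging the two factors passes to the reduced matrix of the complement, up to transposition
   and null rows and columns. *)
move=> H; rewrite /Sent rdm_gram vN_entropy_mulmxC vN_entropy_diag => [|k l kl].
  rewrite -shannon_image -(sum_enum_val (fun z => xlogb d%:R
    (\sum_(c | clear K c == z) weight psi c))).
  congr (- _); apply: eq_bigr => k _.
  congr xlogb; rewrite mxE; under eq_bigr do rewrite !mxE mulrC.
  rewrite sqn_sum /= (sum_enum_val (fun s => sqn (if clear K (enum_val k) ==
    enum_val k then psi (over s (enum_val k)) else 0))).
  have [ck|ck] := boolP (clear K (enum_val k) == enum_val k); last first.
    rewrite big1 => [|s _]; last exact: sqn0.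
    rewrite big_pred0// => c; apply: contraNF ck => /eqP <-.
    by rewrite clear_over.
  rewrite (reindex_onto (fun s => over s (enum_val k)) (restr K)) /=.
    by apply: eq_bigl => s; rewrite clear_over ck restr_over eqxx.
  by move=> c /eqP <-; exact: over_clear.
rewrite mxE big1// => i _; rewrite !mxE.
case: ifP => [/eqP ck|_]; last by rewrite conjc0 mul0r.
case: ifP => [/eqP cl|_]; last by rewrite mulr0.
apply/eqP; apply: contraNT kl; rewrite mulf_eq0 negb_or conjc_eq0 => /andP[c1 c2].
have /H E : psi (over (enum_val i) (enum_val k)) != 0 by [].
rewrite -(inj_eq enum_val_inj) -ck -cl; apply/eqP/eqP/eq_clear.
apply: over_inj (E _ c2 _) => x xK.
by apply/eq_restr: x xK; rewrite !restr_over.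
Qed.

(** The trace over the complement can be taken at [x] first; isometries on a discarded site are
    shown to be invisible this way. *)
Lemma rdm_site psi chi K (x : sys n) : x \notin K ->
  (forall c c', (forall y, y \notin K -> c y = c' y) ->
    \sum_v psi (setc c x v) * conjc (psi (setc c' x v)) =
    \sum_v chi (setc c x v) * conjc (chi (setc c' x v))) ->
  rdm psi K = rdm chi K.
Proof.
move=> xK H; apply/matrixP => i j; rewrite !rdmE big_mkcond [RHS]big_mkcond.
apply: (eq_sum_site (x := x)) => c; rewrite -!big_mkcondr /=.
under eq_bigl do rewrite restr_setc//.
under [RHS]eq_bigl do rewrite restr_setc//.
have [ci|ci] := boolP (restr K c == enum_val i); last by rewrite !big_pred0.
under eq_bigr do rewrite over_setc//.
under [RHS]eq_bigr do rewrite over_setc//.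
by apply: H => y yK; rewrite over_out.
Qed.

End ReducedStates.

(** The hypothesis expresses the push-forward of [m] along [f] by test functions; indicators of
    level sets of [h] suffice. *)
Lemma shannon_push (R : realType) b (I J : finType) (X : eqType) (f : I -> J)
    (m : I -> R) (m' : J -> R) (h : J -> X) :
  (forall F : J -> R, \sum_j m' j * F j = \sum_i m i * F (f i)) ->
  shannon b m' h = shannon b m (h \o f).
Proof.
move=> mm'; congr (- _); rewrite mm'; apply: eq_bigr => i _ /=.
congr (_ * (ln _ / _)); rewrite big_mkcond [RHS]big_mkcond.
have := mm' (fun j => (h j == h (f i))%:R) => /= E.
by under eq_bigr do rewrite -mulrb -mulr_natr; under [RHS]eq_bigr do
   rewrite -mulrb -mulr_natr.
Qed.

(** * Measurement and amplification *)

Section Subsystems.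
Variables (R : realType) (n d : nat) (hd : (0 < d)%N).
Local Notation z0 := (zero_ord hd).
Implicit Types (p : pred 'I_n) (c : config n d) (psi : state R n d).

Lemma sA_Aset p i : (sA i \in Aset p) = p i.
Proof. by apply/imsetP/idP => [[j pj [->]]//|pi]; exists i. Qed.

Lemma sD_Dset p i : (sD i \in Dset p) = p i.
Proof. by apply/imsetP/idP => [[j pj [->]]//|pi]; exists i. Qed.

Lemma sA_Dset p i : (sA i \in Dset p) = false.
Proof. by apply/imsetP => -[]. Qed.

Lemma sD_Aset p i : (sD i \in Aset p) = false.
Proof. by apply/imsetP => -[]. Qed.

Lemma sQ_Aset p : (sQ \in Aset p) = false.
Proof. by apply/imsetP => -[]. Qed.

Lemma sQ_Dset p : (sQ \in Dset p) = false.
Proof. by apply/imsetP => -[]. Qed.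

Definition in_sys := (sA_Aset, sD_Dset, sA_Dset, sD_Aset, sQ_Aset, sQ_Dset).

Lemma AsetU p q : Aset p :|: Aset q = Aset [pred i | p i || q i].
Proof. by apply/setP => -[[i|i]|]; rewrite inE ?in_sys. Qed.

Lemma DsetU p q : Dset p :|: Dset q = Dset [pred i | p i || q i].
Proof. by apply/setP => -[[i|i]|]; rewrite inE ?in_sys. Qed.

Lemma sysP (T : sys n -> Prop) :
  (forall i, T (sA i)) -> (forall i, T (sD i)) -> T sQ -> forall x, T x.
Proof. by move=> TA TD TQ [[i|i]|]; [exact: TA | exact: TD | exact: TQ]. Qed.

Definition copy c : config n d :=
  [ffun x => if x is Some (inr i) then c (sA i) else c x].

Definition reset c : config n d :=
  [ffun x => if x is Some (inr _) then z0 else c x].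

(** Change of variables: the amplified state lives on the image of [copy], and [reset] undoes [copy]
    wherever the detectors are blank. *)
Lemma sum_amplify psi (F : config n d -> R) :
  (forall c, psi c != 0 -> forall i, c (sD i) = z0) ->
  \sum_c weight (amplify hd psi) c * F c = \sum_c weight psi c * F (copy c).
Proof.
move=> psi0; pose D c := [forall i, c (sD i) == c (sA i)].
transitivity (\sum_(c | D c) weight psi (reset c) * F c).
  rewrite [RHS]big_mkcond; apply: eq_bigr => c _.
  rewrite {1}/weight /amplify -/(D c); case: ifP => // _.
  by rewrite sqn0 mul0r.
rewrite (reindex_onto copy reset) => [|c /forallP Dc]; last first.
  by apply/ffunP; apply: sysP => [i|i|]; rewrite !ffunE //= ffunE -(eqP (Dc i)).
rewrite big_mkcond; apply: eq_bigr => c _.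
have -> : D (copy c) by apply/forallP => i; rewrite !ffunE.
have -> : reset (copy c) = reset c.
  by apply/ffunP; apply: sysP => [i|i|]; rewrite !ffunE.
(* Configurations with a nonblank detector are missed by the reindexing, but have zero weight. *)
case: eqP => [->//|rc] /=; have [->|] := eqVneq (weight psi c) 0; first by rewrite mul0r.
rewrite weight_neq0 => /psi0 c0; case: rc; apply/ffunP.
by apply: sysP => [i|i|]; rewrite !ffunE //= c0.
Qed.

(** The ancillae, which lie outside, duplicate the detectors; hence the detectors are in a diagonal
    state with the law of the ancillae. *)
Lemma Sent_amplify psi p :
  (forall c, psi c != 0 -> forall i, c (sD i) = z0) ->
  Sent (amplify hd psi) (Dset p) = shannon d%:R (weight psi) (restr (Aset p)).
Proof.
move=> psi0; rewrite Sent_diag => [|c c' c1 c1' E]; last first.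
  have DA e : amplify hd psi e != 0 -> forall i, e (sD i) = e (sA i).
    by rewrite /amplify; case: ifP => [/forallP De _ i|]; [exact/eqP | rewrite eqxx].
  apply/eqP/eq_restr; apply: sysP => [i|i|]; rewrite in_sys// => _.
  by rewrite !DA// E// in_sys.
rewrite (shannon_push _ (f := copy) (m := weight psi)) => [|F]; last exact: sum_amplify.
apply: eq_shannon => c c' _ _ /=.
apply/eq_restr/eq_restr => H; apply: sysP => [i|i|]; rewrite in_sys// => pi.
  by have := H (sD i); rewrite !ffunE; apply; rewrite in_sys.
by rewrite !ffunE; apply: H; rewrite in_sys.
Qed.

Lemma measure_support (B : 'M[R[i]]_d) i psi x v :
  x != sQ -> x != sA i -> (forall c, psi c != 0 -> c x = v) ->
  forall c, measure hd B i psi c != 0 -> c x = v.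
Proof.
move=> xQ xA H c; apply: contraNeq => cx; rewrite /measure big1// => y _.
have [->|/H] := eqVneq (psi (setc (setc c sQ y) (sA i) z0)) 0; first by rewrite mulr0.
by rewrite !setc_other// => E; rewrite E eqxx in cx.
Qed.

Lemma measures_support (B : 'I_n -> 'M[R[i]]_d) (s : seq 'I_n) psi x v :
  x != sQ -> (forall i, i \in s -> x != sA i) -> (forall c, psi c != 0 -> c x = v) ->
  forall c, foldl (fun psi i => measure hd (B i) i psi) psi s c != 0 -> c x = v.
Proof.
move=> xQ; elim: s psi => [|i s IH] psi xs H //=.
apply: IH => [j js|]; first by apply: xs; rewrite inE js orbT.
by apply: measure_support => //; apply: xs; rewrite mem_head.
Qed.

Lemma init_support (q : 'cV[R[i]]_d) x : x != sQ ->
  forall c, init_state hd q c != 0 -> c x = z0.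
Proof.
move=> xQ c; rewrite /init_state; case: ifP => [/forallP/(_ x)|]; last by rewrite eqxx.
by rewrite xQ => /eqP.
Qed.

End Subsystems.

(** * The last measurement and how to undo it *)

Section LastMeasurement.
Variables (R : realType) (n d : nat) (hd : (0 < d)%N).
Local Notation C := (R[i]).
Local Notation z0 := (zero_ord hd).
Variables (L P : 'I_n) (V U : 'M[C]_d) (g : state R n d).
Hypothesis PL : P != L.
Hypothesis Vunit : forall a b, \sum_y V y a * conjc (V y b) = (a == b)%:R.
Hypothesis Uunit : forall a b, \sum_y U a y * conjc (U b y) = (a == b)%:R.
Hypothesis g_indep : forall c c' : config n d,
  (forall x, x != sQ -> x != sA L -> c x = c' x) -> g c = g c'.
Hypothesis g_support : forall c, g c != 0 -> forall i, c (sD i) = z0.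
Implicit Types (K : {set sys n}) (c : config n d).

(** Normal form after the last measurement: [V] stands for the last basis, [U] for the overlaps with
    the previous one, and [g] for the earlier history. *)
Definition measured : state R n d :=
  fun c => V (c sQ) (c (sA L)) * U (c (sA P)) (c (sA L)) * g c.

(** Here [Q] is written in the last measurement basis, where it copies [sA L]. *)
Definition rotated : state R n d :=
  fun c => if c sQ == c (sA L) then U (c (sA P)) (c (sA L)) * g c else 0.

(** The copying onto [sA L] is undone and [Q] alone carries the outcome. *)
Definition transferred : state R n d :=
  fun c => if c (sA L) == z0 then U (c (sA P)) (c sQ) * g c else 0.

(** The basis change [U] is undone too: this is the state before the last measurement, with [Q] a
    copy of [sA P]. *)
Definition unmeasured : state R n d :=
  fun c => if (c (sA L) == z0) && (c sQ == c (sA P)) then g c else 0.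

Lemma g_setQ c v : g (setc c sQ v) = g c.
Proof. by apply: g_indep => x xQ _; rewrite setc_other. Qed.

Lemma g_setL c v : g (setc c (sA L) v) = g c.
Proof. by apply: g_indep => x _ xL; rewrite setc_other. Qed.

Lemma setc_Q c v i : setc c sQ v (sA i) = c (sA i).
Proof. by rewrite setc_other. Qed.

Lemma setc_LP c v : setc c (sA L) v (sA P) = c (sA P).
Proof. by rewrite setc_other//; apply: contra PL => /eqP[->]. Qed.

Lemma setc_LQ c v : setc c (sA L) v sQ = c sQ.
Proof. by rewrite setc_other. Qed.

Definition site_simpl := (setc_same, setc_Q, setc_LP, setc_LQ, g_setQ, g_setL).

Lemma sum_if_eq (S : nmodType) (F : 'I_d -> S) a :
  \sum_v (if v == a then F v else 0) = F a.
Proof. by rewrite -big_mkcond big_pred1_eq. Qed.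

Lemma rdm_measured K : sQ \notin K -> rdm measured K = rdm rotated K.
Proof.
move=> QK; apply: (rdm_site QK) => c c' _.
rewrite /measured /rotated.
under eq_bigr do rewrite !site_simpl.
under [RHS]eq_bigr do rewrite !site_simpl.
transitivity ((\sum_v V v (c (sA L)) * conjc (V v (c' (sA L)))) *
  (U (c (sA P)) (c (sA L)) * g c * conjc (U (c' (sA P)) (c' (sA L)) * g c'))).
  by rewrite mulr_suml; apply: eq_bigr => v _; rewrite !rmorphM /=; ring.
rewrite Vunit (bigD1 (c (sA L)))//= eqxx big1 ?addr0 => [|v /negPf ->]; last first.
  by rewrite mul0r.
by case: eqP => _; rewrite ?mul1r// conjc0 mulr0 mul0r.
Qed.

(** With [sQ] and [sA L] both discarded, the last measurement acts on the environment only: the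
    copying is undone first, then [U]. *)
Lemma rdm_rotated K : sQ \notin K -> sA L \notin K ->
  rdm rotated K = rdm unmeasured K.
Proof.
move=> QK LK; transitivity (rdm transferred K).
  apply: (rdm_site LK) => c c' /(_ _ QK) cQ.
  rewrite /rotated /transferred.
  under eq_bigr do rewrite !site_simpl.
  under [RHS]eq_bigr do rewrite !site_simpl.
  rewrite (bigD1 (c sQ))//= eqxx -cQ eqxx big1 ?addr0 => [|v]; last first.
    by rewrite eq_sym => /negPf ->; rewrite mul0r.
  rewrite (bigD1 z0)//= ?eqxx big1 ?addr0 => [|v /negPf ->]; last by rewrite mul0r.
  by [].
apply: (rdm_site QK) => c c' _.
rewrite /unmeasured /transferred.
under eq_bigr do rewrite !site_simpl.
under [RHS]eq_bigr do rewrite !site_simpl.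
case: (c (sA L) == z0) => /=; last by rewrite !big1// => v _; rewrite mul0r.
case: (c' (sA L) == z0); last by rewrite !big1// => v _; rewrite [conjc _]conjc0 mulr0.
transitivity ((\sum_v U (c (sA P)) v * conjc (U (c' (sA P)) v)) * (g c * conjc (g c'))).
  by rewrite mulr_suml; apply: eq_bigr => v _; rewrite !rmorphM /=; ring.
rewrite Uunit (bigD1 (c (sA P)))//= eqxx big1 ?addr0 => [|v /negPf ->]; last first.
  by rewrite mul0r.
by case: eqP => _; rewrite ?mul1r// conjc0 mulr0 mul0r.
Qed.

Lemma rotated_support c : rotated c != 0 ->
  c sQ = c (sA L) /\ forall i, c (sD i) = z0.
Proof.
rewrite /rotated; case: ifP => [/eqP ->|]; last by rewrite eqxx.
by rewrite mulf_eq0 negb_or => /andP[_ /g_support].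
Qed.

Lemma unmeasured_support c : unmeasured c != 0 ->
  [/\ c (sA L) = z0, c sQ = c (sA P) & forall i, c (sD i) = z0].
Proof.
rewrite /unmeasured; case: ifP => [/andP[/eqP -> /eqP ->] /g_support//|].
by rewrite eqxx.
Qed.

Local Notation H := (shannon d%:R (weight rotated)).

Lemma Sent_measured K : sQ \notin K -> Sent measured K = Sent rotated K.
Proof. by move=> QK; rewrite /Sent rdm_measured. Qed.

Lemma shannon_measured K : sQ \notin K ->
  shannon d%:R (weight measured) (restr K) = H (restr K).
Proof. by move=> QK; rewrite -!rdm_diag_entropy rdm_measured. Qed.

Lemma shannon_rotated K : sQ \notin K -> sA L \notin K ->
  shannon d%:R (weight unmeasured) (restr K) = H (restr K).
Proof. by move=> QK LK; rewrite -!rdm_diag_entropy rdm_rotated. Qed.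

Lemma eq_restr1 (p : pred 'I_n) j c c' : (forall i, p i = (i == j)) ->
  (restr (Aset p) c == restr (Aset p) c') = (c (sA j) == c' (sA j)).
Proof.
move=> pj; apply/eq_restr/eqP => [|E]; first by apply; rewrite in_sys pj.
by apply: sysP => [i|i|]; rewrite in_sys// pj => /eqP ->.
Qed.

Lemma Sent_last (p : pred 'I_n) : (forall i, p i = (i == L)) ->
  Sent measured (Aset p) = H (fun c => c (sA L)).
Proof.
move=> pL; rewrite Sent_measured ?in_sys// Sent_diag => [|c c' c1 c2 E]; last first.
  apply/eqP; rewrite (eq_restr1 _ _ pL).
  have [<- _] := rotated_support c1; have [<- _] := rotated_support c2.
  by rewrite E ?in_sys.
by apply: eq_shannon => c c' _ _; exact: eq_restr1.
Qed.

(** The environment is [Q] with blank detectors, so duality leaves the entropy of [Q], a copy of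
    [sA L]. *)
Lemma Sent_all (p : pred 'I_n) : (forall i, p i) ->
  Sent measured (Aset p) = H (fun c => c (sA L)).
Proof.
move=> pT; rewrite Sent_measured ?in_sys// (Sent_dual hd) => [|c c' c1 c2 E]; last first.
  have [cQ cD] := rotated_support c1; have [cQ' cD'] := rotated_support c2.
  have EA i : c (sA i) = c' (sA i) by apply: E; rewrite in_sys pT.
  by apply/ffunP; apply: sysP => [i|i|]; rewrite ?cD ?cD' ?cQ ?cQ' ?EA.
apply: eq_shannon => c c'; rewrite !weight_neq0 => c1 c2.
have [cQ cD] := rotated_support c1; have [cQ' cD'] := rotated_support c2.
apply/eq_clear/eqP => [|E]; first by rewrite -cQ -cQ'; apply; rewrite in_sys.
by apply: sysP => [i|i|]; rewrite in_sys ?pT// ?cD ?cD' ?cQ ?cQ'.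
Qed.

(** Discarding [sA L] and [sQ] hides the last measurement; duality then applies to [unmeasured],
    where [Q] copies [sA P]. *)
Lemma Sent_before (p : pred 'I_n) : (forall i, p i = (i != L)) ->
  Sent measured (Aset p) = H (fun c => c (sA P)).
Proof.
move=> pL; rewrite Sent_measured ?in_sys// /Sent rdm_rotated ?in_sys ?pL ?eqxx//.
rewrite -/(Sent unmeasured _) (Sent_dual hd) => [|c c' c1 c2 E]; last first.
  have [cL cQ cD] := unmeasured_support c1; have [cL' cQ' cD'] := unmeasured_support c2.
  have EA i : c (sA i) = c' (sA i).
    have [->|iL] := eqVneq i L; first by rewrite cL cL'.
    by apply: E; rewrite in_sys pL.
  by apply/ffunP; apply: sysP => [i|i|]; rewrite ?cD ?cD' ?cQ ?cQ' ?EA.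
(* The detour through [restr] is needed because the laws of [unmeasured] and [rotated] are compared
   through reduced matrices. *)
transitivity (H (restr (Aset (pred1 P)))); last first.
  by apply: eq_shannon => c c' _ _; exact: eq_restr1.
rewrite -shannon_rotated ?in_sys//=; last by rewrite eq_sym.
apply: eq_shannon => c c'; rewrite !weight_neq0 => c1 c2.
have [cL cQ cD] := unmeasured_support c1; have [cL' cQ' cD'] := unmeasured_support c2.
rewrite (@eq_restr1 _ P)//.
apply/eq_clear/eqP => [|E]; first by rewrite -cQ -cQ'; apply; rewrite in_sys.
apply: sysP => [i|i|]; rewrite in_sys ?pL// ?cD ?cD' ?cQ ?cQ' //.
by rewrite negbK => /eqP ->; rewrite cL cL'.
Qed.

Lemma Sent_le_classical (p : pred 'I_n) :
  Sent measured (Aset p) <= H (restr (Aset p)).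
Proof. by rewrite Sent_measured ?in_sys//; exact: Sent_le_diag. Qed.

(** [Q] lies outside and repeats the value at [sA L], which excludes coherence between different
    values. *)
Lemma Sent_ge_last (p : pred 'I_n) : p L ->
  H (fun c => c (sA L)) <= Sent measured (Aset p).
Proof.
move=> pL; rewrite Sent_measured ?in_sys//; apply: Sent_ge_block => //.
  by rewrite in_sys.
move=> c c' c1 c2 E; have [<- _] := rotated_support c1.
by have [<- _] := rotated_support c2; rewrite E ?in_sys.
Qed.

Lemma marginal_weight K c : sQ \notin K -> sA L \notin K ->
  \sum_(c' | restr K c' == restr K c) weight rotated c' =
  \sum_(c' | restr K c' == restr K c) weight unmeasured c'.
Proof.
move=> QK LK; have := rdm_diag rotated (enum_rank (restr K c)).
by rewrite rdm_rotated// rdm_diag enum_rankK.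
Qed.

(** Born rule for the last step, the source of the Markov property: [g] ignores [sQ] and [sA L], so
    the values at which they are pinned can be moved. *)
Lemma joint_weight K K' c : sQ \notin K -> sA L \notin K -> sA P \in K ->
  (forall x, (x \in K') = (x \in K) || (x == sA L)) ->
  \sum_(c' | restr K' c' == restr K' c) weight rotated c' =
  sqn (U (c (sA P)) (c (sA L))) *
  \sum_(c' | restr K c' == restr K c) weight rotated c'.
Proof.
move=> QK LK PK KK'; rewrite (marginal_weight c QK LK).
(* Common value of both marginals: the weight of [g] with the two sites pinned at [z0]. *)
pose N := \sum_(c' | restr K c' == restr K c)
   (if (c' (sA L) == z0) && (c' sQ == z0) then sqn (g c') else 0).
have -> : \sum_(c' | restr K c' == restr K c) weight unmeasured c' = N.
  rewrite big_mkcond [RHS]big_mkcond; apply: (eq_sum_site (x := sQ)) => e.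
  under eq_bigr do rewrite /weight /unmeasured restr_setc// !site_simpl.
  under [RHS]eq_bigr do rewrite restr_setc// !site_simpl.
  case: (restr K e == restr K c); last by rewrite !big1.
  case: (e (sA L) == z0) => /=; last by rewrite !big1// => v _; exact: sqn0.
  rewrite sum_if_eq -[RHS](sum_if_eq (fun=> sqn (g e)) (e (sA P))).
  by apply: eq_bigr => v _; case: ifP => // _; exact: sqn0.
transitivity (sqn (U (c (sA P)) (c (sA L))) * \sum_(c' | restr K c' == restr K c)
   (if (c' (sA L) == c (sA L)) && (c' sQ == c' (sA L)) then sqn (g c') else 0)).
  rewrite mulr_sumr big_mkcond [RHS]big_mkcond; apply: eq_bigr => c' _.
  have -> : (restr K' c' == restr K' c) =
      (restr K c' == restr K c) && (c' (sA L) == c (sA L)).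
    apply/eq_restr/andP => [E|[/eq_restr E /eqP EL] x].
      split; last by apply/eqP/E; rewrite KK' eqxx orbT.
      by apply/eq_restr => x xK; apply: E; rewrite KK' xK.
    by rewrite KK' => /orP[/E //|/eqP ->].
  case: eq_restr => //= E; rewrite /weight /rotated.
  case: eqP => [cL|_] /=; last by rewrite mulr0.
  case: ifP => _; last by rewrite mulr0 sqn0.
  by rewrite sqnM E// cL.
(* The pin of [sQ] is moved to [z0] first, then that of [sA L]. *)
congr (_ * _); transitivity (\sum_(c' | restr K c' == restr K c)
   (if (c' (sA L) == c (sA L)) && (c' sQ == z0) then sqn (g c') else 0)).
  rewrite big_mkcond [RHS]big_mkcond; apply: (eq_sum_site (x := sQ)) => e.
  under eq_bigr do rewrite restr_setc// !site_simpl.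
  under [RHS]eq_bigr do rewrite restr_setc// !site_simpl.
  case: (restr K e == restr K c); last by rewrite !big1.
  by case: (e (sA L) == c (sA L)) => /=; rewrite ?sum_if_eq// !big1.
rewrite /N big_mkcond [RHS]big_mkcond; apply: (eq_sum_site (x := sA L)) => e.
under eq_bigr do rewrite restr_setc// !site_simpl andbC.
under [RHS]eq_bigr do rewrite restr_setc// !site_simpl andbC.
case: (restr K e == restr K c); last by rewrite !big1.
by case: (e sQ == z0) => /=; rewrite ?sum_if_eq// !big1.
Qed.

(* The right-hand correction, the conditional entropy of the last outcome, only
   involves the previous outcome: the outcomes form a Markov chain. *)
Lemma shannon_chain K K' : sQ \notin K -> sA L \notin K -> sA P \in K ->
  (forall x, (x \in K') = (x \in K) || (x == sA L)) ->
  H (restr K') = H (restr K) -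
    \sum_c weight rotated c *
      (ln (sqn (U (c (sA P)) (c (sA L)))) / ln d%:R).
Proof.
move=> QK LK PK KK'; rewrite /shannon -opprD -big_split /=; congr (- _).
apply: eq_bigr => c _; have [->|] := eqVneq (weight rotated c) 0.
  by rewrite !mul0r addr0.
move=> w0; have c0 : rotated c != 0 by rewrite -weight_neq0.
have U0 : 0 < sqn (U (c (sA P)) (c (sA L))).
  rewrite lt0r sqn_ge0 andbT sqn_eq0; apply: contraNneq c0.
  by rewrite /rotated => ->; rewrite mul0r if_same.
have p0 : 0 < \sum_(c' | restr K c' == restr K c) weight rotated c'.
  rewrite (bigD1 c)//= ltr_pwDl ?lt0r ?w0 ?sqn_ge0//.
  by apply: sumr_ge0 => i _; exact: sqn_ge0.
by rewrite (joint_weight c QK LK PK KK') lnM ?posrE// -mulrDr -mulrDl addrC.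
Qed.

End LastMeasurement.

(** * Normal form of the unamplified state and the final inequality *)

Lemma unitary_cols (R : realType) d (B : 'M[R[i]]_d) : unitary B ->
  forall a b, \sum_y B y a * conjc (B y b) = (a == b)%:R.
Proof.
move=> /matrixP BB a b; have := BB b a; rewrite mxE eq_sym !mxE => <-.
by apply: eq_bigr => y _; rewrite !mxE mulrC.
Qed.

(** Only the last two measurements are unfolded: [U] collects the overlaps of their bases, and [g]
    absorbs the earlier ones with the component of [Q] recorded by [sA P]. *)
Lemma unamplified_measured (R : realType) m d (hd : (0 < d)%N)
    (B : 'I_m.+2 -> 'M[R[i]]_d) (q : 'cV[R[i]]_d)
    (L := ord_max : 'I_m.+2)
    (P := widen_ord (leqnSn m.+1) ord_max) :
  (forall i, unitary (B i)) ->
  exists (U : 'M[R[i]]_d) (g : state R m.+2 d),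
  [/\ forall a b, \sum_y U a y * conjc (U b y) = (a == b)%:R,
      forall c c' : config m.+2 d, (forall x, x != sQ -> x != sA L -> c x = c' x) -> g c = g c',
      forall c, g c != 0 -> forall i, c (sD i) = zero_ord hd
    & unamplified hd B q = measured L P (B L) U g].
Proof.
move=> Bu; pose z0 := zero_ord hd.
have [s sE] : exists s : seq 'I_m.+2, enum 'I_m.+2 = rcons (rcons s P) L.
  by rewrite enum_ordSr enum_ordSr map_rcons; eexists.
have PL : P != L by rewrite -val_eqE /= neq_ltn ltnSn.
pose chi := foldl (fun psi i => measure hd (B i) i psi) (init_state hd q) s.
pose G (e : config m.+2 d) := \sum_y conjc (B P y (e (sA P))) *
  chi (setc (setc e sQ y) (sA P) z0).
pose W := (map_mx conjc (B L))^T *m B P.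
have Wu : unitary W.
  rewrite /unitary /W map_mxM trmx_mul mulmxA -[X in X *m _]mulmxA.
  have -> : (map_mx conjc (map_mx conjc (B L))^T)^T = B L.
    by apply/matrixP => a b; rewrite !mxE conjcK.
  by rewrite (mulmx1C (Bu L)) mulmx1 Bu.
(* The transpose puts the earlier outcome first; [sA L] is set to zero because the last measurement
   finds its ancilla blank. *)
exists W^T, (fun c => G (setc c (sA L) z0)); split.
- by move=> a b; rewrite -(unitary_cols Wu); apply: eq_bigr => y _; rewrite !mxE.
- move=> c c' cc'; rewrite /G; apply: eq_bigr => y _.
  have cP : c (sA P) = c' (sA P) by rewrite cc'//; apply: contra PL => /eqP[->].
  rewrite !setc_LP// cP; congr (_ * chi _); apply/ffunP => x; rewrite !ffunE.
  by case: eqP => // _; case: eqP => // /eqP xQ; case: eqP => // /eqP xL; exact: cc'.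
- move=> c; rewrite /G => nz i; apply: contraNeq nz => ci; rewrite big1// => y _.
  have [->|] := eqVneq (chi (setc (setc (setc c (sA L) z0) sQ y) (sA P) z0)) 0.
    by rewrite mulr0.
  move=> /(measures_support (x := sD i) (v := z0)) chi0.
  have {}chi0 : setc (setc (setc c (sA L) z0) sQ y) (sA P) z0 (sD i) = z0.
    by apply: chi0 => // e; exact: init_support.
  by move: chi0 ci; rewrite !setc_other// => ->; rewrite eqxx.
apply/funext => c; rewrite /unamplified sE -!cats1 !foldl_cat /= -/chi.
rewrite /measured {1}/measure !mxE mulr_sumr mulr_suml; apply: eq_bigr => y _.
rewrite !mxE -!mulrA; congr (_ * (_ * _)).
rewrite /measure /G mulr_sumr; apply: eq_bigr => y' _.
rewrite !setc_LP// !setc_LQ !setc_same !setc_Q -mulrA; congr (_ * (_ * chi _)).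
apply/ffunP => x; rewrite !ffunE.
by do 3![case: eqP => //].
Qed.

(* A_n = A (ord n-1), A_(n-1) = A (ord n-2); A_(n-1)...A_1 = indices < n-1 *)
Theorem theorem6 (R : realType) (n d : nat) (hd : (0 < d)%N) (hn : (2 <= n)%N)
    (B : 'I_n -> 'M[R[i]]_d) (q : 'cV[R[i]]_d) :
  (forall i, unitary (B i)) ->
  \sum_(x : 'I_d) `|q x 0| ^+ 2 = 1 ->
  let psi := unamplified hd B q in
  let phi := amplify hd psi in
  let last := [pred i : 'I_n | val i == n.-1] in
  let prev := [pred i : 'I_n | val i == n.-2] in
  let before := [pred i : 'I_n | (i < n.-1)%N] in
  let Sigma := Scond psi (Aset prev) (Aset last) in
  0 <= Sigma /\
  Smut phi (Dset last) (Dset before) <= Smut psi (Aset last) (Aset before) - Sigma.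
Proof.
case: n hn B => [|[|m]]// hn B Bu _ psi phi last prev before Sigma.
have [U [g [Uu gi gs psiE]]] := unamplified_measured hd q Bu.
pose L : 'I_m.+2 := ord_max; pose P : 'I_m.+2 := widen_ord (leqnSn m.+1) ord_max.
have PL : P != L by rewrite -val_eqE /= neq_ltn ltnSn.
have lastE i : last i = (i == L) by [].
have beforeE i : before i = (i != L).
  by rewrite -val_eqE /= ltn_neqAle -ltnS ltn_ord andbT.
have Vu := unitary_cols (Bu L).
pose H (X : eqType) (h : config m.+2 d -> X) :=
  shannon d%:R (weight (rotated L P U g)) h.
pose hL := H _ (fun c : config m.+2 d => c (sA L)).
pose hP := H _ (fun c : config m.+2 d => c (sA P)).
(* [- cond] is the conditional entropy of the last outcome given the previous one. *)
pose cond := \sum_c weight (rotated L P U g) c *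
  (ln (sqn (U (c (sA P)) (c (sA L)))) / ln d%:R).
have SD p : Sent phi (Dset p) = H _ (restr (Aset p)).
  rewrite /phi Sent_amplify => [|c]; last first.
    by rewrite /psi psiE mulf_eq0 negb_or => /andP[_ /gs].
  by rewrite /psi psiE (shannon_measured P U Vu gi) ?in_sys.
have chain (p p' : pred 'I_m.+2) : p P -> (forall i, p' i = p i || (i == L)) -> ~~ p L ->
    H _ (restr (Aset p')) = H _ (restr (Aset p)) - cond.
  move=> pP pp' pL; apply: (shannon_chain hd PL Uu gi); rewrite ?in_sys//.
  by apply: sysP => [i|i|]; rewrite ?in_sys ?pp'.
have SL : Sent psi (Aset last) = hL by rewrite /psi psiE (Sent_last P U Vu gi gs).
have Sall : Sent psi (Aset last :|: Aset before) = hL.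
  rewrite /psi psiE AsetU (Sent_all P U Vu gi gs)// => i.
  by have : last i || before i by rewrite lastE beforeE orbN.
have Sbefore : Sent psi (Aset before) = hP.
  by rewrite /psi psiE (Sent_before PL Vu Uu gi gs).
(* The lower bound is the block structure and yields [0 <= Sigma]; the upper one is dephasing
   followed by the chain rule. *)
have Spair : hL <= Sent psi (Aset prev :|: Aset last) <= hP - cond.
  rewrite /psi psiE AsetU (Sent_ge_last P U Vu gi gs) /= ?eqxx ?orbT//=.
  apply: le_trans (Sent_le_classical hd P U Vu gi _) _.
  rewrite -/(H _ _) (@chain prev)//=; last by rewrite eq_sym.
  by rewrite lerD2r le_eqVlt; apply/orP; left; apply/eqP; apply: eq_shannon => c c' _ _;
    exact: eq_restr1.
have Dlast : Sent phi (Dset last) = hL.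
  by rewrite SD; apply: eq_shannon => c c' _ _; exact: eq_restr1.
have Dall : Sent phi (Dset last :|: Dset before) = Sent phi (Dset before) - cond.
  rewrite DsetU !SD; apply: chain; rewrite ?beforeE ?eqxx// => i.
  by rewrite /= orbC.
(* The entropy of the earlier detectors cancels, so the claim is the upper half of [Spair]. *)
rewrite /Sigma /Scond /Smut SL Sall Sbefore Dlast Dall.
by move: Spair => /andP[Sge Sle]; split; lra.
Qed.
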